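(* There is an absolute constant $c_1 > 0$ such that for every integer $n \geq 0$, the $n$-th Rudin-Shapiro polynomials $P_n$ and $Q_n$ satisfy $$M_0(P_n,[0,2\pi]) = M_0(Q_n,[0,2\pi]) \geq c_1\sqrt{N}\,,$$ where $N := 2^n = \deg(P_n)+1 = \deg(Q_n)+1$.
   Context: The Rudin-Shapiro polynomials are defined recursively by $P_0(z) := 1$, $Q_0(z) := 1$, and $$P_{n+1}(z) := P_n(z) + z^{2^n}Q_n(z)\,, \qquad Q_{n+1}(z) := P_n(z) - z^{2^n}Q_n(z)\,, \qquad n=0,1,2,\ldots.$$ For real numbers $\alpha<\beta$ and a polynomial $Q$ (not identically zero), the Mahler measure on $[\alpha,\beta]$ is $$M_0(Q,[\alpha,\beta]) := \exp\left(\frac{1}{\beta-\alpha}\int_\alpha^\beta \log|Q(e^{it})|\,dt\right).$$ *)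

(* Defs.v *)
From HB Require Import structures.
From mathcomp Require Export all_boot all_order all_algebra.
From mathcomp Require Export complex.
From mathcomp Require Export all_classical all_reals all_analysis.
Set Implicit Arguments.
Unset Strict Implicit.
Unset Printing Implicit Defensive.
Import Order.TTheory GRing.Theory Num.Theory.
Local Open Scope classical_set_scope.
Local Open Scope ring_scope.
Local Open Scope complex_scope.

Fixpoint rudin_shapiro (R : realType) (n : nat) : {poly R[i]} * {poly R[i]} :=
  match n with
  | 0%N => (1, 1)
  | m.+1 => let: (P, Q) := rudin_shapiro R m in
            (P + 'X^(2 ^ m) * Q, P - 'X^(2 ^ m) * Q)
  end.

Definition rsP (R : realType) (n : nat) : {poly R[i]} := (rudin_shapiro R n).1.
Definition rsQ (R : realType) (n : nat) : {poly R[i]} := (rudin_shapiro R n).2.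

Definition cis (R : realType) (t : R) : R[i] := cos t +i* sin t.

(* Intended for a < b and Q != 0.  The norm of R[i] takes its values in R[i]
   (as nonnegative reals), hence the real part.  The library sets ln 0 = 0;
   this only affects the finitely many t in [a, b] with Q(e^{it}) = 0.  For
   nonzero Q the integrand is Lebesgue integrable (its singularities are
   logarithmic), so the value of Rintegral is the actual integral. *)
Definition mahler (R : realType) (Q : {poly R[i]}) (a b : R) : R :=
  expR ((b - a)^-1 *
    \int[lebesgue_measure]_(t in `[a, b]) ln (complex.Re `|Q.[cis t]|)).

(* Main.v *)
Require Import Defs.
From mathcomp Require Import ring lra zify measurable_realfun.
Import Order.TTheory GRing.Theory Num.Theory.
Set Implicit Arguments.
Unset Strict Implicit.
Unset Printing Implicit Defensive.
Local Open Scope ring_scope.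

(** Jensen's formula turns the Mahler measure of a polynomial c (X - a_1) ... (X - a_d)
    into |c| max(1, |a_1|) ... max(1, |a_d|), so the two claims become statements about
    values of P_n and Q_n on the unit circle and about their roots.

    Equality of the two measures: for |z| = 1, |Q_n(z)| = |P_n(-z)|, because Q_n is up to
    sign the reciprocal polynomial of P_n(-X) (rs_reciprocal); replacing X by -X only
    changes the sign of the roots.

    Lower bound, for n >= 2, with N = 2^n and w = cis (2 pi / N).  At an N-th root of
    unity z, |P_n(z)| equals 2|P_{n-2}(z)| or 2|Q_{n-2}(z)| according to the sign of
    z^(N/2) (cmod_rs_grid), and this sign alternates along consecutive roots.  Moreover
    |P_{n-2}|^2 + |Q_{n-2}|^2 is constant on the circle, and the vector
    (P_{n-2}, Q_{n-2}) moves little, up to a common phase, when z is replaced by zw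
    (rs_drift): the recursion is a sum and difference, which doubles squared norms, and
    at step m the factor z^(2^m) changes by the angle 2 pi 2^m / N.  If P_{n-2} were
    small at z and Q_{n-2} small at zw, the vector would have made a quarter turn.  So of
    two neighbouring N-th roots of unity at least one is good, meaning |P_n|^2 >= N/16.

    If all N-th roots z were good, the product over z of |P_n(z)| would equal the product
    over the roots a of P_n of |a^N - 1|, which is at most the product of the
    2 max(1, |a|)^N, and the bound on the Mahler measure would follow by taking N-th
    roots.  At a bad z the factor (z - a)^2 is replaced by (z/w - a)(zw - a), which
    involves two good points.  For |a| = 1 the new factor has modulus
    ||1 - w|^2 - |z - a|^2| (cmod_neighbours), hence it is no larger than the old one
    unless |z - a| < |1 - w|; since bad points are isolated this exception occurs for at
    most one z (circle_close_pair), and it multiplies the product by a bounded factor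
    (grid_poly_circle).  The maximum modulus principle and the reflection a -> 1/conj(a)
    extend the estimate from the circle to every a (grid_poly_bound), which gives the
    comparison sampling_mahler between good sample values and the Mahler measure. *)

(** * The modulus on the complex numbers and the unit circle *)

Section Modulus.
Local Open Scope complex_scope.
Variable R : realType.
Implicit Types z w : R[i].

(** The norm of R[i] takes its values in R[i]; this is the same modulus as a
    real number, so that real arithmetic applies to it. *)
Definition cmod z : R := complex.Re `|z|.

Lemma cmod_normE z : (cmod z)%:C = `|z|.
Proof. by rewrite /cmod normc_def. Qed.

Lemma sqr_cmod z : cmod z ^+ 2 = complex.Re z ^+ 2 + complex.Im z ^+ 2.
Proof. by apply: complexI; rewrite rmorphXn /= cmod_normE add_Re2_Im2. Qed.

Lemma cmod_ge0 z : 0 <= cmod z.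
Proof. by rewrite -ler0c cmod_normE. Qed.

Lemma cmodM z w : cmod (z * w) = cmod z * cmod w.
Proof. by apply: complexI; rewrite rmorphM /= !cmod_normE normrM. Qed.

Lemma cmodN z : cmod (- z) = cmod z.
Proof. by rewrite /cmod normrN. Qed.

Lemma cmod_distC z w : cmod (z - w) = cmod (w - z).
Proof. by rewrite -cmodN opprB. Qed.

Lemma cmodD z w : cmod (z + w) <= cmod z + cmod w.
Proof. by rewrite -lecR rmorphD /= !cmod_normE ler_normD. Qed.

Lemma cmodB z w : cmod z - cmod w <= cmod (z - w).
Proof. by rewrite lerBlDr (le_trans _ (cmodD _ _))// subrK. Qed.

Lemma cmod_real (x : R) : cmod x%:C = `|x|.
Proof. by rewrite /cmod normc_def /= expr0n addr0 sqrtr_sqr. Qed.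

Lemma cmod0 : cmod 0 = 0.
Proof. by rewrite /cmod normr0. Qed.

Lemma cmod1 : cmod 1 = 1.
Proof. by rewrite /cmod normr1. Qed.

Lemma cmod_eq0 z : (cmod z == 0) = (z == 0).
Proof. by rewrite -(inj_eq (@complexI R)) cmod_normE normr_eq0. Qed.

Lemma cmod_gt0 z : (0 < cmod z) = (z != 0).
Proof. by rewrite lt_def cmod_eq0 cmod_ge0 andbT. Qed.

Lemma cmodX z n : cmod (z ^+ n) = cmod z ^+ n.
Proof. by elim: n => [|n IH]; rewrite ?cmod1// !exprS cmodM IH. Qed.

Lemma cmodV z : cmod z^-1 = (cmod z)^-1.
Proof.
by apply: complexI; rewrite fmorphV /= !cmod_normE normfV.
Qed.

Lemma cmod_prod (I : Type) (s : seq I) (P : pred I) (F : I -> R[i]) :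
  cmod (\prod_(i <- s | P i) F i) = \prod_(i <- s | P i) cmod (F i).
Proof. by rewrite (big_morph cmod cmodM cmod1). Qed.

Lemma cmod_sum (I : Type) (s : seq I) (P : pred I) (F : I -> R[i]) :
  cmod (\sum_(i <- s | P i) F i) <= \sum_(i <- s | P i) cmod (F i).
Proof.
elim/big_ind2: _ => [|x1 x2 y1 y2 h1 h2|//]; first by rewrite cmod0.
by rewrite (le_trans (cmodD _ _))// lerD.
Qed.

Lemma cmod_conj z : cmod (conjc z) = cmod z.
Proof. by case: z => a b; rewrite /cmod !normc_def /= sqrrN. Qed.

Lemma conjcB z w : conjc (z - w) = conjc z - conjc w.
Proof. exact: rmorphB. Qed.

Lemma mulc_conj z : z * (conjc z) = (cmod z ^+ 2)%:C.
Proof. by case: z => a b; rewrite sqr_cmod; simpc; congr (_ +i* _); ring. Qed.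

Lemma conjc_unit z : cmod z = 1 -> (conjc z) = z^-1.
Proof.
move=> z1; have z0 : z != 0 by rewrite -cmod_gt0 z1.
by apply: (mulfI z0); rewrite mulc_conj z1 expr1n mulfV.
Qed.

Lemma parallelogram z w :
  cmod (z + w) ^+ 2 + cmod (z - w) ^+ 2 = 2 * (cmod z ^+ 2 + cmod w ^+ 2).
Proof. by case: z w => [a b] [c d]; rewrite !sqr_cmod /=; ring. Qed.

Lemma cmod_cis (t : R) : cmod (cis t) = 1.
Proof.
by apply/eqP; rewrite -(@eqrXn2 _ 2)// ?cmod_ge0// sqr_cmod /= cos2Dsin2 expr1n.
Qed.

Lemma cisD (s t : R) : cis (s + t) = cis s * cis t.
Proof. by rewrite /cis cosD sinD; simpc; congr (_ +i* _); ring. Qed.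

Lemma cis0 : cis (0 : R) = 1.
Proof. by rewrite /cis cos0 sin0. Qed.

Lemma cisN (t : R) : cis (- t) = conjc (cis t).
Proof. by rewrite /cis cosN sinN. Qed.

Lemma cisMn (t : R) n : cis (t *+ n) = cis t ^+ n.
Proof. by elim: n => [|n IH]; rewrite ?cis0// mulrS cisD IH exprS. Qed.

Lemma cis_pi : cis (pi : R) = -1.
Proof. by rewrite /cis cospi sinpi; apply/eqP; rewrite eq_complex /= oppr0 !eqxx. Qed.

Lemma cis_2pi : cis (2 * pi : R) = 1.
Proof. by rewrite mulr_natl cisMn cis_pi expr2 mulrNN mulr1. Qed.

End Modulus.

(** * Integrals of continuous periodic functions *)

Section PeriodicIntegral.
Import numFieldNormedType.Exports.
Local Open Scope classical_set_scope.
Local Open Scope ring_scope.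
Local Open Scope complex_scope.
Variable R : realType.
Notation mu := (@lebesgue_measure R).

Lemma continuous_itv_integrable (g : R -> R) (a b : R) :
  continuous g -> mu.-integrable `[a, b] (EFin \o g).
Proof.
move=> cg; apply: continuous_compact_integrable; first exact: segment_compact.
exact: continuous_subspaceT.
Qed.

Lemma Rintegral_affine (g : R -> R) (k c a b : R) : 0 < k -> a <= b ->
  continuous g ->
  \int[mu]_(t in `[k * a + c, k * b + c]) g t =
  k * \int[mu]_(t in `[a, b]) g (k * t + c).
Proof.
move=> k0 ab cg; pose F := fun t : R => k * t + c.
have dF (t : R) : is_derive t 1 F k.
  have -> : k = k *: 1 + 0 :> R by rewrite addr0 /GRing.scale /= mulr1.
  by apply: is_deriveD.
have FE : derive1 F = cst k by apply/funext => t; rewrite derive1E; exact: derive_val.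
have cF : continuous F.
  by move=> t; apply: differentiable_continuous; apply/derivable1_diffP.
have cgF : continuous (fun t => g (F t)).
  by move=> t; apply: continuous_comp; [exact: cF | exact: cg].
rewrite -RintegralZl//; last exact: continuous_itv_integrable.
rewrite /Rintegral -[k * a + c]/(F a) -[k * b + c]/(F b).
rewrite integration_by_substitution_increasing//.
- congr fine; apply: eq_integral => t _; rewrite FE /=.
  by rewrite -[((g \o F) * cst k) t]/(g (F t) * k) mulrC.
- by move=> x y _ _ xy; rewrite /F ltrD2r ltr_pM2l.
- by rewrite FE => x _; exact: cvg_cst.
- by rewrite FE; exact: is_cvg_cst.
- by rewrite FE; exact: is_cvg_cst.
- split; first by move=> x _.
  + by apply: cvg_at_right_filter; exact: cF.
  + by apply: cvg_at_left_filter; exact: cF.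
- exact: continuous_subspaceT.
Qed.

Lemma Rintegral_split (g : R -> R) (a b c : R) : a <= b -> b <= c ->
  continuous g ->
  \int[mu]_(t in `[a, c]) g t =
  \int[mu]_(t in `[a, b]) g t + \int[mu]_(t in `[b, c]) g t.
Proof.
move=> ab bc cg.
rewrite -[in RHS](@Rintegral_itv_obnd_cbnd _ b); last first.
  apply: integrableS (continuous_itv_integrable b c cg) => //.
  exact: subset_itv_oc_cc.
rewrite -(@Rintegral_itvB _ g (BLeft a) (BRight c) b) ?bnd_simp//.
  by rewrite addrC subrK.
exact: continuous_itv_integrable.
Qed.

Lemma Rintegral_shift_period (g : R -> R) (T c : R) : 0 <= c <= T ->
  continuous g -> (forall t, g (t + T) = g t) ->
  \int[mu]_(t in `[0, T]) g (t + c) = \int[mu]_(t in `[0, T]) g t.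
Proof.
move=> /andP[c0 cT] cg pg.
have E (a b d : R) : a <= b -> \int[mu]_(t in `[a, b]) g (t + d) =
    \int[mu]_(t in `[a + d, b + d]) g t.
  move=> ab; have := @Rintegral_affine g 1 d a b ltr01 ab cg.
  by rewrite !mul1r => ->; apply: eq_Rintegral => t _; rewrite mul1r.
rewrite E ?(le_trans c0)// add0r (@Rintegral_split g c T (T + c)) ?lerDl//.
rewrite (@Rintegral_split g 0 c T)// addrC; congr (_ + _).
rewrite -{1}[T]add0r [T + c]addrC -E//.
by apply: eq_Rintegral => t _; rewrite pg.
Qed.

Lemma Rintegral_double_period (g : R -> R) (T : R) : 0 <= T ->
  continuous g -> (forall t, g (t + T) = g t) ->
  \int[mu]_(t in `[0, T]) g (2 * t) = \int[mu]_(t in `[0, T]) g t.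
Proof.
move=> T0 cg pg.
have := @Rintegral_affine g 2 0 0 T (ltr0Sn _ 1) T0 cg.
rewrite mulr0 !addr0 (@Rintegral_split g 0 T (2 * T)) ?ler_peMl ?ler1n//.
have := @Rintegral_affine g 1 T 0 T ltr01 T0 cg.
rewrite mulr0 add0r !mul1r -mulr2n mulr_natl => ->.
rewrite (@eq_Rintegral _ _ _ mu _ g (fun x => g (1 * x + T))); last first.
  by move=> t _; rewrite mul1r pg.
rewrite (@eq_Rintegral _ _ _ mu _ (fun x => g (2 * x)) (fun x => g (2 * x + 0))).
  by lra.
by move=> t _; rewrite addr0.
Qed.

End PeriodicIntegral.

(** * Jensen's formula for a root inside the unit circle *)

Section Jensen.
Import numFieldNormedType.Exports.
Local Open Scope classical_set_scope.
Local Open Scope ring_scope.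
Local Open Scope complex_scope.
Variable R : realType.
Notation mu := (@lebesgue_measure R).
Implicit Types a b : R[i].

Definition logdist a (t : R) : R := ln (cmod (cis t - a)).

Lemma continuous_cmod_cis a : continuous (fun t : R => cmod (cis t - a)).
Proof.
have -> : (fun t : R => cmod (cis t - a)) = (fun t : R => Num.sqrt
    ((cos t - complex.Re a) ^+ 2 + (sin t - complex.Im a) ^+ 2)).
  by apply/funext => t; case: a => x y; rewrite /cmod normc_def.
move=> t; apply: (@continuous_comp _ _ _ (fun t : R =>
  (cos t - complex.Re a) ^+ 2 + (sin t - complex.Im a) ^+ 2) (@Num.sqrt R));
  last exact: sqrt_continuous.
apply: cvgD.
- apply: (@continuous_comp _ _ _ (fun t : R => cos t - complex.Re a)
    (fun x : R => x ^+ 2)); last exact: exprn_continuous.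
  by apply: cvgB; [exact: continuous_cos | exact: cvg_cst].
- apply: (@continuous_comp _ _ _ (fun t : R => sin t - complex.Im a)
    (fun x : R => x ^+ 2)); last exact: exprn_continuous.
  by apply: cvgB; [exact: continuous_sin | exact: cvg_cst].
Qed.

Lemma cmod_cisB_bounds a (t : R) : 1 - cmod a <= cmod (cis t - a) <= 1 + cmod a.
Proof.
rewrite -(cmod_cis t) cmodB /=.
by rewrite (le_trans (cmodD _ _))// cmodN.
Qed.

Lemma continuous_logdist a : cmod a < 1 -> continuous (logdist a).
Proof.
move=> a1 t; apply: (@continuous_comp _ _ _ (fun t : R => cmod (cis t - a)) (@ln R)).
  exact: continuous_cmod_cis.
by apply: continuous_ln; case/andP: (cmod_cisB_bounds a t); lra.
Qed.

Lemma cis_periodic (t : R) : cis (t + 2 * pi) = cis t.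
Proof. by rewrite cisD cis_2pi mulr1. Qed.

(** Since (cis t - a)(cis (t + pi) - a) = a^2 - cis (2 t), the average of
    logdist a over t and t + pi is half of logdist (a^2) at 2 t; shifting and doubling
    the variable do not change the integral of a periodic function. *)
Lemma logdist_double a : cmod a < 1 ->
  2 * \int[mu]_(t in `[0, 2 * pi]) logdist a t =
  \int[mu]_(t in `[0, 2 * pi]) logdist (a ^+ 2) t.
Proof.
move=> a1; have a2 : cmod (a ^+ 2) < 1.
  by rewrite cmodX expr_lt1 ?cmod_ge0.
have pi0 := pi_ge0 R.
rewrite -(@Rintegral_double_period _ (logdist (a ^+ 2)) (2 * pi))//; last 3 first.
- by lra.
- exact: continuous_logdist.
- by move=> t; rewrite /logdist cis_periodic.
rewrite mulr_natl mulr2n -{2}(@Rintegral_shift_period _ (logdist a) (2 * pi) pi)//;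
  last 3 first.
- by apply/andP; split; lra.
- exact: continuous_logdist.
- by move=> t; rewrite /logdist cis_periodic.
have cl := continuous_logdist a1.
rewrite -RintegralD//; last 2 first.
- exact: continuous_itv_integrable.
- apply: continuous_itv_integrable => t.
  apply: (@continuous_comp _ _ _ (fun t : R => t + pi) (logdist a)); last exact: cl.
  by apply: cvgD; [exact: cvg_id | exact: cvg_cst].
apply: eq_Rintegral => t _; rewrite /logdist.
have p (s : R) : 0 < cmod (cis s - a).
  by case/andP: (cmod_cisB_bounds a s); lra.
rewrite -lnM ?posrE// -cmodM cisD cis_pi mulrN1 mulr_natl cisMn -cmodN.
by congr (ln (cmod _)); ring.
Qed.

(** Iterating the doubling identity, 2^m times the integral for a is the integral
    for a^(2^m), and the latter stays bounded because |a^(2^m)| <= |a| < 1. *)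
Lemma jensen_inside a : cmod a < 1 -> \int[mu]_(t in `[0, 2 * pi]) logdist a t = 0.
Proof.
move=> a1; set J := fun b => \int[mu]_(t in `[0, 2 * pi]) logdist b t.
have a0 := cmod_ge0 a.
have le1 m : cmod (a ^+ (2 ^ m)) <= cmod a.
  by rewrite cmodX ler_iXnr ?expn_gt0// ltW.
have JE m : 2 ^+ m * J a = J (a ^+ (2 ^ m)).
  elim: m => [|m IH]; first by rewrite expr1 mul1r.
  rewrite exprS -mulrA IH expnSr exprM; apply: logdist_double.
  exact: le_lt_trans (le1 m) a1.
(* for |b| <= |a|, |cis t - b| lies between 1 - |a| and 1 + |a| <= (1 - |a|)^-1 *)
pose B := - ln (1 - cmod a) * (2 * pi).
have JB b : cmod b <= cmod a -> `|J b| <= B.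
  move=> ba; have b1 := le_lt_trans ba a1.
  have ib := @continuous_itv_integrable R _ 0 (2 * pi) (continuous_logdist b1).
  apply: le_trans (le_normr_Rintegral _ ib) _ => //.
  have -> : B = \int[mu]_(t in `[0, 2 * pi]) (- ln (1 - cmod a)).
    rewrite Rintegral_cst//= /B lebesgue_measure_itv /= lte_fin mulr_gt0 ?pi_gt0//.
    by rewrite oppr0 adde0.
  apply: le_Rintegral => //.
  - exact: integrable_norm.
  - by apply: continuous_itv_integrable => t; exact: cvg_cst.
  move=> t _; have /andP[l1 l2] := cmod_cisB_bounds b t.
  rewrite ler_norml opprK; apply/andP; split.
    by rewrite /logdist ler_ln ?posrE; lra.
  rewrite -lnV ?posrE; last by lra.
  rewrite /logdist ler_ln ?posrE ?invr_gt0; try lra.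
  rewrite -[leRHS]mul1r ler_pdivlMr; last by lra.
  by nra.
apply/eqP; apply: contraT => J0; have {}J0 : 0 < `|J a| by rewrite normr_gt0.
have /archi_boundP : 0 <= B / `|J a|.
  by rewrite divr_ge0// (le_trans _ (JB a _)).
set m := Num.bound _ => mB.
have := JB _ (le1 m); rewrite -JE normrM ger0_norm ?exprn_ge0// => h.
move: mB; rewrite ltr_pdivrMr// => mB.
have : m%:R <= 2 ^+ m :> R by rewrite -natrX ler_nat ltnW// ltn_expl.
move=> /(ler_wpM2r (ltW J0)) m2.
by have := lt_le_trans mB (le_trans m2 h); rewrite ltxx.
Qed.

End Jensen.

(** * Jensen's formula for a root on the unit circle *)

Section JensenCircle.
Import numFieldNormedType.Exports.
Local Open Scope classical_set_scope.
Local Open Scope ring_scope.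
Local Open Scope complex_scope.
Variable R : realType.
Notation mu := (@lebesgue_measure R).
Notation period := (`[0%R, 2 * pi]%classic : set R).
Implicit Types a b : R[i].

Lemma cis_inj_period (s t : R) : 0 <= s -> s < t -> t <= 2 * pi -> cis s = cis t ->
  s = 0 /\ t = 2 * pi.
Proof.
move=> s0 st t2 st1.
have [|h] := ltP ((t - s) / 2) pi; last by split; lra.
move=> h; have s0' : 0 < sin ((t - s) / 2).
  by apply: sin_gt0_pi; apply/andP; split; lra.
have : cis (t - s) = 1 by rewrite cisD -st1 cisN mulc_conj cmod_cis expr1n.
move=> /(congr1 (@complex.Re R)) /=.
have -> : t - s = ((t - s) / 2) *+ 2 by rewrite -mulr_natr; field.
rewrite cos_mulr2n -mulr_natl => c1.
by have cs := cos2Dsin2 ((t - s) / 2); exfalso; nra.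
Qed.

(** A point of the circle has one argument in [0, 2 pi], except that 1 has the
    two arguments 0 and 2 pi. *)
Lemma negligible_cis a : mu.-negligible [set t : R | 0 <= t <= 2 * pi /\ cis t = a].
Proof.
set A := [set t : R | _].
suff [s sA] : exists s : R, A `<=` [set s; (0 : R); (2 * pi : R)].
  have cA : countable [set s; (0 : R); (2 * pi : R)].
    by apply: finite_set_countable; rewrite -!setUA; do ?[exact: finite_set1 | rewrite finite_setU; split].
  exists [set s; (0 : R); (2 * pi : R)]; split => //.
    exact: countable_measurable.
  exact: countable_lebesgue_measure0.
have [->|/set0P[s [/andP[s0 s2] sa]]] := eqVneq A set0.
  by exists 0; exact: sub0set.
exists s => t [/andP[t0 t2] ta].
case: (ltgtP s t) => [st|ts|<-]; last by left; left.
- by right; have [] := cis_inj_period s0 st t2 (etrans sa (esym ta)).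
- by left; right; have [] := cis_inj_period t0 ts s2 (etrans ta (esym sa)).
Qed.

(** Moving a point a of the circle radially inwards cannot bring it much closer
    to z: this is what dominates logdist (r a) by logdist a. *)
Lemma sqr_cmod_radial (r : R) (z a : R[i]) : cmod z = 1 -> cmod a = 1 ->
  cmod (z - r%:C * a) ^+ 2 = (1 - r) ^+ 2 + r * cmod (z - a) ^+ 2.
Proof.
move=> /(congr1 (fun x => x ^+ 2)) + /(congr1 (fun x => x ^+ 2)).
case: z a => [x y] [u v]; rewrite !sqr_cmod /= !expr1n => h1 h2.
transitivity ((x ^+ 2 + y ^+ 2) - 2 * r * (x * u + y * v) +
  r ^+ 2 * (u ^+ 2 + v ^+ 2)); first by ring.
transitivity ((1 - r) ^+ 2 + r * ((x ^+ 2 + y ^+ 2) - 2 * (x * u + y * v) +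
  (u ^+ 2 + v ^+ 2))); last by ring.
by rewrite h1 h2; ring.
Qed.

Lemma measurable_logdist a (D : set R) : measurable_fun D (logdist a).
Proof.
apply: (@measurable_funS _ _ _ _ setT) => //.
apply: (@measurableT_comp _ _ _ _ _ _ (@ln R) _ (fun t : R => cmod (cis t - a))).
  exact: measurable_ln.
by apply: continuous_measurable_fun; exact: continuous_cmod_cis.
Qed.

(* radii in [1/2, 1[ that increase to 1 *)
Let r (n : nat) : R := 1 - harmonic n / 2.

Let r_bound n : 1 / 2 <= r n < 1.
Proof.
have h0 : 0 < harmonic n :> R by rewrite /harmonic /= invr_gt0 ltr0Sn.
have h1 : harmonic n <= 1 :> R by rewrite /harmonic /= invf_le1 ?ltr0Sn// ler1n.
by rewrite /r; apply/andP; split; lra.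
Qed.

Let cvg_r : r @ \oo --> (1 : R).
Proof.
rewrite -[X in _ --> X](subr0 1) -[X in _ - X](mul0r (2^-1)).
apply: cvgB; first exact: cvg_cst.
by apply: cvgMl; exact: cvg_harmonic.
Qed.

Let cmod_r a n : cmod a = 1 -> cmod ((r n)%:C * a) < 1.
Proof.
move=> a1; case/andP: (r_bound n) => *; rewrite cmodM a1 mulr1 cmod_real ger0_norm; lra.
Qed.

Lemma cvg_logdist a (t : R) : cmod a = 1 -> cis t != a ->
  logdist ((r n)%:C * a) t @[n --> \oo] --> logdist a t.
Proof.
move=> a1 ta; have x0 : 0 < cmod (cis t - a) by rewrite cmod_gt0 subr_eq0.
pose h (s : R) := Num.sqrt ((1 - s) ^+ 2 + s * cmod (cis t - a) ^+ 2).
have h1 : h 1 = cmod (cis t - a).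
  by rewrite /h subrr expr0n add0r mul1r sqrtr_sqr ger0_norm// ltW.
have hr s : cmod (cis t - s%:C * a) = h s.
  by rewrite /h -sqr_cmod_radial ?cmod_cis// sqrtr_sqr ger0_norm// cmod_ge0.
rewrite /logdist -h1; under eq_cvg do rewrite hr.
apply: (@continuous_cvg _ _ _ _ _ (fun n => h (r n)) (@ln R)).
  by apply: continuous_ln; rewrite h1.
apply: (@continuous_cvg _ _ _ _ _ (fun n => (1 - r n) ^+ 2 +
  r n * cmod (cis t - a) ^+ 2) (@Num.sqrt R)); first exact: sqrt_continuous.
apply: cvgD; last by apply: cvgM; [exact: cvg_r | exact: cvg_cst].
apply: (@continuous_cvg _ _ _ _ _ (fun n => 1 - r n) (fun x : R => x ^+ 2)).
  exact: exprn_continuous.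
by apply: cvgB; [exact: cvg_cst | exact: cvg_r].
Qed.

Lemma cmod_cisB_le2 b (t : R) : cmod b <= 1 -> cmod (cis t - b) <= 2.
Proof. by move=> b1; case/andP: (cmod_cisB_bounds b t); lra. Qed.

Lemma logdist_le b (t : R) : cmod b <= 1 -> logdist b t <= ln 2.
Proof.
move=> /(@cmod_cisB_le2 _ t) b2; rewrite /logdist.
have := cmod_ge0 (cis t - b); rewrite le_eqVlt => /orP[/eqP <-|b0].
  by rewrite ln0// ln_ge0// ler1n.
by rewrite ler_ln ?posrE.
Qed.

(** Fatou's lemma along the radii r n: the nonnegative functions
    ln 2 - logdist (r n a) all have integral 2 pi ln 2 by jensen_inside. *)
Lemma integrable_logdist_circle a : cmod a = 1 ->
  mu.-integrable period (EFin \o logdist a).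
Proof.
move=> a1; have pi0 := pi_gt0 R.
pose f n (t : R) : \bar R := (ln 2 - logdist ((r n)%:C * a) t)%:E.
have mf n : measurable_fun period (f n).
  by apply/measurable_EFinP; apply: measurable_funB => //; exact: measurable_logdist.
have f0 n t : period t -> (0 <= f n t)%E.
  by move=> _; rewrite lee_fin subr_ge0 logdist_le// ltW// cmod_r.
have := @fatou _ _ _ mu period _ f mf f0 => /(_ (measurable_itv _)).
pose g (t : R) : \bar R := (ln 2 - logdist a t)%:E.
have intc : mu.-integrable period (EFin \o (fun=> ln 2 : R)).
  by apply: continuous_itv_integrable => t; exact: cvg_cst.
have -> : (fun n => \int[mu]_(x in period) f n x)%E =
    (fun=> (ln 2 * (2 * pi))%:E).
  apply/funext => n; have := cmod_r n a1 => c1.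
  have intl := continuous_itv_integrable 0 (2 * pi) (continuous_logdist c1).
  rewrite -[LHS]fineK.
    congr (_%:E); have := @RintegralB _ _ _ mu period (fun=> ln 2) _ (measurable_itv _) intc intl.
    rewrite /Rintegral => -> /=; rewrite -!/(Rintegral _ _ _) jensen_inside// subr0.
    rewrite Rintegral_cst//= lebesgue_measure_itv /= lte_fin mulr_gt0// oppr0 adde0.
    by [].
  apply: integrable_fin_num => //.
  have := @integrableB _ _ _ mu period (measurable_itv _) _ _ intc intl.
  by apply: eq_integrable => // t _ /=; rewrite EFinB.
rewrite is_cvg_limn_einfE; last exact: is_cvg_cst.
rewrite (@cvg_lim _ _ _ _ _ (fun=> (ln 2 * (2 * pi))%:E) ((ln 2 * (2 * pi))%:E))//;
  last exact: cvg_cst.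
move=> le_f.
have le_g : (\int[mu]_(x in period) g x <= (ln 2 * (2 * pi))%:E)%E.
  apply: le_trans le_f; apply: ge0_le_integral => //.
  - by move=> t _; rewrite lee_fin subr_ge0 logdist_le// a1.
  - by apply/measurable_EFinP; apply: measurable_funB => //; exact: measurable_logdist.
  - rewrite (_ : (fun t => limn_einf (f ^~ t)) =
        (fun t => - limn_esup (fun n => - f n t))%E); last first.
      by apply/funext => t; rewrite -[LHS]oppeK -limn_esupN.
    apply: measurableT_comp => //; apply: measurable_fun_limn_esup => n.
    by apply: measurableT_comp => //; exact: mf.
  move=> t _; have [ta|ta] := eqVneq (cis t) a.
    (* at the singularity, ln 0 = 0 while the logarithms of the distances 1 - r n are
       negative, so the inequality holds there too *)
    rewrite limn_einf_lim; apply: lime_ge; first exact: is_cvg_einfs.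
    apply: nearW => n; apply: le_ereal_inf_tmp => _ [m _ <-].
    rewrite /g /f lee_fin lerB// /logdist {1}[in leRHS]ta subrr cmod0 (ln0 (lexx 0)).
    apply: ln_le0; rewrite ta -{1}[a]mul1r -mulrBl cmodM a1 mulr1 -rmorphB /= cmod_real.
    by case/andP: (r_bound m) => *; rewrite ger0_norm; lra.
  rewrite is_cvg_limn_einfE; last first.
    apply/cvg_ex; exists (g t); apply: cvg_EFin; first exact: nearW.
    by apply: cvgB; [exact: cvg_cst | exact: cvg_logdist].
  rewrite (_ : limn _ = g t)//; apply/cvg_lim => //.
  apply: cvg_EFin; first exact: nearW.
  by apply: cvgB; [exact: cvg_cst | exact: cvg_logdist].
have ig : mu.-integrable period g.
  apply/integrableP; split.
    by apply/measurable_EFinP; apply: measurable_funB => //; exact: measurable_logdist.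
  apply: le_lt_trans (ltry (ln 2 * (2 * pi))); apply: le_trans le_g.
  apply: ge0_le_integral => //.
  - apply/measurableT_comp => //.
    by apply/measurable_EFinP; apply: measurable_funB => //; exact: measurable_logdist.
  - by apply/measurable_EFinP; apply: measurable_funB => //; exact: measurable_logdist.
  - by move=> t _; rewrite /= ger0_norm// subr_ge0 logdist_le// a1.
have := @integrableB _ _ _ mu period (measurable_itv _) _ _ intc ig.
apply: eq_integrable => // t _ /=.
by rewrite -EFinB; congr (_%:E); ring.
Qed.

(** Dominated convergence along the radii r n; the arguments t with
    cis t = a, where neither convergence nor domination holds, are negligible. *)
Lemma jensen_circle a : cmod a = 1 -> \int[mu]_(t in period) logdist a t = 0.
Proof.
move=> a1; have ia := integrable_logdist_circle a1.
pose f n (t : R) : \bar R := (logdist ((r n)%:C * a) t)%:E.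
pose g (t : R) : \bar R := (ln 2 + `|logdist a t|)%:E.
have mf n : measurable_fun period (f n).
  by apply/measurable_EFinP; exact: measurable_logdist.
have mfa : measurable_fun period (EFin \o logdist a).
  by apply/measurable_EFinP; exact: measurable_logdist.
have ae P : (forall t : R, cis t != a -> P t) ->
    {ae mu, forall t, period t -> P t}.
  move=> Pt; apply: negligibleS (negligible_cis a) => t /= /not_implyP[].
  rewrite in_itv /= => t2 nP; split=> //; apply/eqP; apply: contrapT => ta.
  by apply: nP; apply: Pt; apply/negP.
have cv : {ae mu, forall t, period t -> f ^~ t @ \oo --> (EFin \o logdist a) t}.
  apply: ae => t ta; apply: cvg_EFin; first exact: nearW.
  exact: cvg_logdist.
have dom : {ae mu, forall t n, period t -> (`|f n t| <= g t)%E}.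
  suff : {ae mu, forall t, period t -> forall n, (`|f n t| <= g t)%E}.
    case=> A [mA A0 AS]; exists A; split=> // t h.
    by apply: AS => h2; apply: h => n Dt; exact: h2.
  apply: ae => t ta n; rewrite lee_fin.
  have x0 : 0 < cmod (cis t - a) by rewrite cmod_gt0 subr_eq0.
  have r1 := cmod_r n a1.
  have y0 : 0 < cmod (cis t - (r n)%:C * a).
    by case/andP: (cmod_cisB_bounds ((r n)%:C * a) t); lra.
  have l1 : logdist ((r n)%:C * a) t <= ln 2 by apply: logdist_le; exact: ltW.
  have l2 : logdist a t - ln 2 <= logdist ((r n)%:C * a) t.
    rewrite /logdist -ln_div ?posrE// ler_ln ?posrE ?divr_gt0//.
    rewrite -(@ler_pXn2r _ 2)// ?nnegrE ?divr_ge0 ?cmod_ge0//.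
    rewrite sqr_cmod_radial ?cmod_cis//; case/andP: (r_bound n) => rn1 rn2.
    rewrite expr_div_n; have : 0 < cmod (cis t - a) ^+ 2 by rewrite exprn_gt0.
    by move: (cmod _ ^+ 2) => x; nra.
  by rewrite ler_norml; have := ler_norm (- logdist a t); rewrite normrN;
     have := ler_norm (logdist a t); have := normr_ge0 (logdist a t) => *; lra.
have ig : mu.-integrable period g.
  have intc : mu.-integrable period (EFin \o (fun=> ln 2 : R)).
    by apply: continuous_itv_integrable => t; exact: cvg_cst.
  have := @integrableD _ _ _ mu period (measurable_itv _) _ _ intc (integrable_norm ia).
  by apply: eq_integrable.
have [_ _] := @dominated_convergence _ _ _ mu period (measurable_itv _) _ _ _ mf mfa cv ig dom.
have -> : [sequence (\int[mu]_(x in period) (f n x))%E]_n = (fun=> 0%E).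
  apply/funext => n /=; have c1 := cmod_r n a1.
  rewrite -[LHS]fineK; last first.
    apply: integrable_fin_num => //.
    exact: (continuous_itv_integrable 0 (2 * pi) (continuous_logdist c1)).
  by rewrite -[fine _]/(Rintegral _ _ _) jensen_inside.
move=> /cvg_lim /= /(_ _)/esym h; rewrite /Rintegral h ?lim_cst//.
Qed.

End JensenCircle.

(** * Jensen's formula for a polynomial *)

Section JensenFormula.
Import numFieldNormedType.Exports.
Local Open Scope classical_set_scope.
Local Open Scope ring_scope.
Local Open Scope complex_scope.
Variable R : realType.
Notation mu := (@lebesgue_measure R).
Notation period := (`[0%R, 2 * pi]%classic : set R).
Implicit Types a b : R[i].

(** The reflection a -> 1/conj(a) in the unit circle multiplies all distances to
    points of the circle by the same factor. *)
Lemma cmodB_reflect (z a : R[i]) : cmod z = 1 -> a != 0 ->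
  cmod (z - a) = cmod a * cmod (z - (conjc a)^-1).
Proof.
move=> z1 a0; have ac0 : (conjc a) != 0 by rewrite conjc_eq0.
rewrite -[cmod a]cmod_conj -cmodM mulrBr mulfV//.
have -> : (conjc a) * z - 1 = conjc (a * (conjc z) - 1).
  by rewrite rmorphB rmorphM rmorph1; congr (_ * _ - _); rewrite [RHS]conjcK.
have zc : cmod (conjc z) = 1 by rewrite cmod_conj.
rewrite cmod_conj -[LHS]mul1r -{1}zc -cmodM mulrBr [(conjc z) * z]mulrC mulc_conj z1 expr1n.
by rewrite cmod_distC mulrC.
Qed.

Lemma Rintegral_cst_period (x : R) : \int[mu]_(t in period) x = 2 * pi * x.
Proof.
rewrite Rintegral_cst//= lebesgue_measure_itv /= lte_fin mulr_gt0 ?pi_gt0//.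
by rewrite oppr0 adde0 mulrC.
Qed.

Lemma integrable_cst_period (x : R) : mu.-integrable period (EFin \o (fun=> x)).
Proof. by apply: continuous_itv_integrable => t; exact: cvg_cst. Qed.

Lemma jensen_factor a : mu.-integrable period (EFin \o logdist a) /\
  \int[mu]_(t in period) logdist a t = 2 * pi * ln (Num.max 1 (cmod a)).
Proof.
have [a1|a1|a1] := ltgtP (cmod a) 1.
- rewrite ln1 mulr0 jensen_inside//; split=> //.
  exact: continuous_itv_integrable (continuous_logdist a1).
- have a0 : a != 0 by rewrite -cmod_gt0; lra.
  have b1 : cmod (conjc a)^-1 < 1.
    by rewrite cmodV cmod_conj invf_lt1//; lra.
  have E : logdist a = fun t => ln (cmod a) + logdist (conjc a)^-1 t.
    apply/funext => t; rewrite /logdist cmodB_reflect ?cmod_cis// lnM ?posrE ?cmod_gt0//.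
    by rewrite -cmod_gt0; case/andP: (cmod_cisB_bounds (conjc a)^-1 t); lra.
  have ib := continuous_itv_integrable 0 (2 * pi) (continuous_logdist b1).
  have ic := integrable_cst_period (ln (cmod a)).
  rewrite E; split; last first.
    by rewrite RintegralD// jensen_inside// addr0 Rintegral_cst_period.
  have := @integrableD _ _ _ mu period (measurable_itv _) _ _ ic ib.
  exact: eq_integrable.
- rewrite a1 ?maxxx ln1 mulr0 jensen_circle//; split=> //.
  exact: integrable_logdist_circle.
Qed.

Lemma jensen_sum (x : R) (s : seq R[i]) :
  let g := fun t => x + \sum_(a <- s) logdist a t in
  mu.-integrable period (EFin \o g) /\
  \int[mu]_(t in period) g t =
    2 * pi * (x + \sum_(a <- s) ln (Num.max 1 (cmod a))).
Proof.
elim: s => [|a s [IH1 IH2]] /=.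
  have -> : (fun t : R => x + \sum_(a <- [::]) logdist a t) = (fun=> x).
    by apply/funext => t; rewrite big_nil addr0.
  rewrite big_nil addr0 Rintegral_cst_period; split=> //.
  exact: integrable_cst_period.
have [ia Ja] := jensen_factor a.
have -> : (fun t => x + \sum_(b <- a :: s) logdist b t) =
    (fun t => logdist a t + (x + \sum_(b <- s) logdist b t)).
  by apply/funext => t; rewrite big_cons addrCA.
rewrite RintegralD// Ja IH2 big_cons; split; last by ring.
have := @integrableD _ _ _ mu period (measurable_itv _) _ _ ia IH1.
exact: eq_integrable.
Qed.

(** Where cis t is a root, the convention ln 0 = 0 breaks the additivity of the
    logarithm. *)
Lemma negligible_cis_seq (s : seq R[i]) :
  mu.-negligible [set t : R | 0 <= t <= 2 * pi /\ cis t \in s].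
Proof.
elim: s => [|a s [A [mA A0 sA]]].
  by exists set0; split => // t [].
have [B [mB B0 aB]] := negligible_cis a.
exists (B `|` A); split; first exact: measurableU.
  by rewrite null_set_setU.
move=> t [t0]; rewrite inE => /orP[/eqP ta|ts]; first by left; exact: aB.
by right; exact: sA.
Qed.

(** The logarithm of |p(cis t)| is the sum of the logdist of the roots and of
    ln |c|, except at the finitely many t where p vanishes. *)
Lemma jensen_formula (c : R[i]) (s : seq R[i]) : c != 0 ->
  mahler (c *: \prod_(a <- s) ('X - a%:P)) 0 (2 * pi) =
  cmod c * \prod_(a <- s) Num.max 1 (cmod a).
Proof.
move=> c0; rewrite /mahler subr0.
pose g (t : R) := ln (cmod c) + \sum_(a <- s) logdist a t.
have pE (t : R) : cmod (c *: \prod_(a <- s) ('X - a%:P)).[cis t] =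
    cmod c * \prod_(a <- s) cmod (cis t - a).
  rewrite hornerZ horner_prod cmodM cmod_prod.
  by congr (_ * _); apply: eq_bigr => a _; rewrite !hornerE.
have [ig Jg] := jensen_sum (ln (cmod c)) s.
rewrite -/(g) in ig Jg.
have -> : \int[mu]_(t in period) ln (cmod (c *: \prod_(a <- s) ('X - a%:P)).[cis t])
    = \int[mu]_(t in period) g t.
  congr fine; apply: ae_eq_integral => //.
  - apply/measurable_EFinP; apply: (@measurable_funS _ _ _ _ setT) => //.
    apply: (@measurableT_comp _ _ _ _ _ _ (@ln R)); first exact: measurable_ln.
    rewrite (funext pE); apply: measurable_funM => //.
    apply: measurable_prod => a _.
    by apply: continuous_measurable_fun; exact: continuous_cmod_cis.
  - by case/integrableP: ig.
  case: (negligible_cis_seq s) => A [mA A0 sA]; exists A; split => // t h.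
  apply: sA => /=; move: h => /= /not_implyP[]; rewrite in_itv /= => t2 h.
  split=> //; apply: contrapT => /negP ts; apply: h; congr (_%:E).
  rewrite pE lnM ?posrE ?cmod_gt0//; last first.
    rewrite big_seq prodr_gt0// => a sa; rewrite cmod_gt0 subr_eq0.
    by apply: contraNneq ts => ->.
  congr (_ + _); elim: s ts {pE g ig Jg} => [_|a s IH].
    by rewrite !big_nil ln1.
  rewrite inE negb_or => /andP[ta ts]; rewrite !big_cons lnM ?IH//.
    by rewrite posrE cmod_gt0 subr_eq0.
  rewrite posrE big_seq prodr_gt0// => b sb; rewrite cmod_gt0 subr_eq0.
  by apply: contraNneq ts => ->.
rewrite Jg mulKf ?mulf_neq0 ?pnatr_eq0 ?gt_eqF ?pi_gt0//.
rewrite expRD lnK ?posrE ?cmod_gt0//; congr (_ * _).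
elim: s {pE g ig Jg} => [|a s IH]; first by rewrite !big_nil expR0.
by rewrite !big_cons expRD IH lnK// posrE lt_max ltr01.
Qed.

End JensenFormula.

(** * The maximum modulus principle for polynomials *)

Section MaxModulus.
Local Open Scope complex_scope.
Variable R : realType.
Implicit Types (q : {poly R[i]}) (z a : R[i]).

Lemma cis_prim_root n : (0 < n)%N -> n.-primitive_root (cis (2 * pi / n%:R : R)).
Proof.
move=> n0; have n0R : 0 < n%:R :> R by rewrite ltr0n.
have piR := pi_gt0 R.
have X k : cis (2 * pi / n%:R : R) ^+ k = cis (2 * pi / n%:R * k%:R : R).
  by rewrite -cisMn mulr_natr.
rewrite /primitive_root_of_unity n0; apply/forallP => -[k kn] /=.
rewrite unity_rootE X; apply/eqP; have [->|kn'] := eqVneq k.+1 n.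
  by rewrite divfK ?lt0r_neq0// cis_2pi eqxx.
apply/negbTE/eqP => h; have {kn kn'} : (k.+1 < n)%N by rewrite ltn_neqAle kn'.
rewrite -(ltr_nat R) => kn; have k0 : 0 < k.+1%:R :> R by rewrite ltr0Sn.
set e : R := 2 * pi / n%:R * k.+1%:R in h *.
have e0 : 0 < e by rewrite /e !mulr_gt0 ?invr_gt0.
have e2 : e < 2 * pi by rewrite /e mulrAC ltr_pdivrMr// ltr_pM2l// mulr_gt0.
have [e1 _] := cis_inj_period (ltW e0) e2 (lexx _) (etrans h (esym (cis_2pi R))).
by rewrite e1 ltxx in e0.
Qed.

Lemma sum_prim_root n (w : R[i]) j k : n.-primitive_root w -> (j < n)%N -> (k < n)%N ->
  \sum_(l < n) (w ^+ l) ^+ j * (w ^+ l) ^- k = if j == k then n%:R else 0.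
Proof.
move=> pw jn kn; have wU : w != 0.
  by apply/eqP => w0; have := prim_expr_order pw; rewrite w0 expr0n
    -[n == 0%N]negbK -lt0n (prim_order_gt0 pw) => /eqP; rewrite eq_sym oner_eq0.
have wE (l : 'I_n) : (w ^+ l) ^+ j * (w ^+ l) ^- k = (w ^+ j / w ^+ k) ^+ l.
  by rewrite expr_div_n -!exprM ![(_ * l)%N]mulnC.
rewrite (eq_bigr _ (fun l _ => wE l)); have [->|jk] := eqVneq j k.
  rewrite mulfV ?expf_neq0// (eq_bigr (fun=> 1)) => [|l _]; last by rewrite expr1n.
  by rewrite sumr_const card_ord.
have x1 : w ^+ j / w ^+ k != 1.
  apply: contra_neq jk => /(congr1 ( *%R^~ (w ^+ k))).
  rewrite mulfVK ?expf_neq0// mul1r => /eqP; rewrite (eq_prim_root_expr pw).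
  by rewrite !modn_small// => /eqP.
have := subrX1 (w ^+ j / w ^+ k) n.
rewrite expr_div_n -!exprM mulnC exprM (prim_expr_order pw) expr1n.
rewrite mulnC exprM (prim_expr_order pw) expr1n divr1 subrr => /esym/eqP.
by rewrite mulf_eq0 subr_eq0 (negbTE x1) => /eqP.
Qed.

(** A coefficient of q is the average, over the n-th roots of unity x, of
    q(x) x^-k as soon as n exceeds the degree. *)
Lemma coef_le_circle q (C : R) k : (forall z, cmod z = 1 -> cmod q.[z] <= C) ->
  cmod q`_k <= C.
Proof.
move=> qC; have C0 : 0 <= C.
  by apply: le_trans (qC 1 (cmod1 R)); exact: cmod_ge0.
have [sk|ks] := leqP (size q) k; first by rewrite nth_default// cmod0.
set n := size q in ks; have n0 : (0 < n)%N by apply: leq_ltn_trans ks.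
have pw := cis_prim_root n0; set w := cis _ in pw.
have w1 l : cmod (w ^+ l) = 1 by rewrite cmodX cmod_cis expr1n.
have E : n%:R * q`_k = \sum_(l < n) q.[w ^+ l] * (w ^+ l) ^- k.
  under eq_bigr do rewrite horner_coef mulr_suml.
  rewrite exchange_big /= (bigD1 (Ordinal ks))//= [X in _ + X]big1 ?addr0 => [|j jk].
    under eq_bigr do rewrite -mulrA.
    by rewrite -mulr_sumr sum_prim_root// eqxx mulrC.
  under eq_bigr do rewrite -mulrA.
  by rewrite -mulr_sumr sum_prim_root// -[k]/(val (Ordinal ks)) (inj_eq val_inj) (negbTE jk) mulr0.
have nR : 0 < n%:R :> R by rewrite ltr0n.
rewrite -(ler_pM2l nR) -{1}[n%:R](@ger0_norm R) ?ler0n// -cmod_real -cmodM rmorph_nat E.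
apply: le_trans (cmod_sum _ _ _) _.
rewrite mulr_natl -[in leRHS](card_ord n) -sumr_const; apply: ler_sum => l _.
by rewrite cmodM cmodV cmodX w1 expr1n invr1 mulr1 qC.
Qed.

(** Bounding the coefficients gives the inequality up to the factor size q.
    Applied to q^m, whose size grows only linearly in m, it yields
    |q(a)|^m <= O(m) C^m, which forces |q(a)| <= C. *)
Lemma max_modulus q (C : R) : (forall z, cmod z = 1 -> cmod q.[z] <= C) ->
  forall a, cmod a <= 1 -> cmod q.[a] <= C.
Proof.
move=> qC a a1; have C0 : 0 <= C.
  by apply: le_trans (qC 1 (cmod1 R)); exact: cmod_ge0.
have crude p (D : R) : (forall z, cmod z = 1 -> cmod p.[z] <= D) ->
    cmod p.[a] <= (size p)%:R * D.
  move=> pD; have D0 : 0 <= D.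
    by apply: le_trans (pD 1 (cmod1 R)); exact: cmod_ge0.
  rewrite horner_coef; apply: le_trans (cmod_sum _ _ _) _.
  rewrite mulr_natl -[in leRHS](card_ord (size p)) -sumr_const; apply: ler_sum => l _.
  rewrite cmodM -[leRHS]mulr1 ler_pM ?cmod_ge0 ?coef_le_circle// cmodX.
  by rewrite exprn_ile1 ?cmod_ge0.
set d := (size q).-1.
have pow m : cmod q.[a] ^+ m <= (d * m).+1%:R * C ^+ m.
  have := crude (q ^+ m) (C ^+ m) _; rewrite horner_exp cmodX => /(_ _) le1.
  apply: le_trans (le1 _) _.
    by move=> z z1; rewrite horner_exp cmodX lerXn2r ?nnegrE ?cmod_ge0// qC.
  by rewrite ler_wpM2r ?exprn_ge0// ler_nat size_poly_exp_leq.
rewrite leNgt; apply/negP => Cx; set x := cmod q.[a] in pow Cx.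
have [C_0|Cn0] := eqVneq C 0.
  by have := pow 1%N; rewrite expr1 C_0 expr1 mulr0; lra.
have {}C0 : 0 < C by rewrite lt_def Cn0.
pose h := x / C - 1; have h0 : 0 < h by rewrite /h subr_gt0 ltr_pdivlMr// mul1r.
have pow1 m : (1 + h) ^+ m <= (d * m).+1%:R.
  by rewrite /h addrC subrK expr_div_n ler_pdivrMr ?exprn_gt0.
have bern m : 1 + m%:R * h <= (1 + h) ^+ m.
  elim: m => [|m IH]; first by rewrite mul0r addr0 expr0.
  rewrite exprS -natr1; have := ler0n R m; nra.
(* (1 + h)^m grows at least like 1 + m h, so its square eventually beats any
   bound that is linear in m *)
have fin (m : nat) : m%:R * h ^+ 2 <= (2 * d).+1%:R.
  have := pow1 (m * 2)%N; rewrite exprM => b2.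
  have [->|m0] := posnP m; first by rewrite mul0r.
  have mR : 1 <= m%:R :> R by rewrite ler1n.
  have b1 := bern m; move: b2; rewrite -natr1 -[(2 * d).+1%:R]natr1 !natrM.
  have dR := ler0n R d; set M := m%:R in mR b1 *; set D := d%:R in dR *.
  move=> b2; have : (M * h) ^+ 2 <= D * (M * 2) + 1.
    by apply: le_trans b2; rewrite lerXn2r ?nnegrE; nra.
  by rewrite exprMn; have := sqr_ge0 h => *; nra.
have h2 : 0 < h ^+ 2 by rewrite exprn_gt0.
have := archi_boundP (divr_ge0 (ler0n R (2 * d).+1) (ltW h2)).
by rewrite ltr_pdivrMr// ltNge fin.
Qed.

End MaxModulus.

(** * Chords of the unit circle *)

Section Chords.
Import numFieldNormedType.Exports.
Local Open Scope complex_scope.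
Variable R : realType.
Implicit Types (z a w : R[i]).

Lemma sqr_cmod_1Bcis (t : R) : cmod (1 - cis t) ^+ 2 = 2 - 2 * cos t.
Proof. by rewrite sqr_cmod /=; have := cos2Dsin2 t => *; nra. Qed.

Lemma normr_sin_le (x : R) : 0 <= x -> `|sin x| <= x.
Proof.
move=> x0; have [|c _] := @MVT_segment _ (@sin R) (@cos R) 0 x x0 (fun y _ => is_derive_sin y).
  by apply: continuous_subspaceT; exact: continuous_sin.
by rewrite sin0 !subr0 => ->; rewrite normrM (ger0_norm x0) ler_piMl// cos_max.
Qed.

Lemma cmod_1Bcis_le (t : R) : 0 <= t -> cmod (1 - cis t) <= t.
Proof.
move=> t0; rewrite -(@ler_pXn2r _ 2)// ?nnegrE ?cmod_ge0//.
rewrite sqr_cmod_1Bcis; have -> : cos t = cos ((t / 2) *+ 2).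
  by congr cos; rewrite -mulr_natr; field.
have /normr_sin_le : 0 <= t / 2 by lra.
rewrite ler_norml => /andP[s1 s2].
rewrite cos_mulr2n [_ *+ 2]mulr2n; have cs := cos2Dsin2 (t / 2).
have : 0 <= (t / 2 - sin (t / 2)) * (t / 2 + sin (t / 2)) by rewrite mulr_ge0//; lra.
by move: cs; set c := cos _; set u := sin _; nra.
Qed.

Lemma cos_le_away (h t : R) : 0 <= h -> h <= t -> t <= 2 * pi - h -> cos t <= cos h.
Proof.
move=> h0 ht t2; have hpi : h <= pi by lra.
have mono (x y : R) : 0 <= x -> x <= y -> y <= pi -> cos y <= cos x.
  move=> x0 xy ypi; rewrite leNgt ltr_cos ?in_itv /=; last 2 first.
  - by apply/andP; split; lra.
  - by apply/andP; split; lra.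
  by rewrite -leNgt.
have [tpi|tpi] := leP t pi; first exact: mono.
have -> : cos t = cos (2 * pi - t).
  by rewrite mulr_natl cosB cos2pi sin2pi mul1r mul0r addr0.
by apply: mono; lra.
Qed.

(** On the circle (z - a)^2 / (z a) is real and nonpositive, since conjugation
    is inversion. *)
Lemma cmodB_circle_sqr z a : cmod z = 1 -> cmod a = 1 ->
  (z - a) ^+ 2 = - (cmod (z - a) ^+ 2)%:C * (z * a).
Proof.
move=> z1 a1; rewrite -mulc_conj. rewrite conjcB (conjc_unit z1) (conjc_unit a1).
have z0 : z != 0 by rewrite -cmod_gt0 z1.
have a0 : a != 0 by rewrite -cmod_gt0 a1.
by field; rewrite z0 a0.
Qed.

(** (z/w - a)(zw - a) = (z - a)^2 + |1 - w|^2 z a, and both terms are real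
    multiples of z a of opposite signs. *)
Lemma cmod_neighbours z a w : cmod z = 1 -> cmod a = 1 -> cmod w = 1 ->
  cmod ((z / w - a) * (z * w - a)) = `|cmod (1 - w) ^+ 2 - cmod (z - a) ^+ 2|.
Proof.
move=> z1 a1 w1; have w0 : w != 0 by rewrite -cmod_gt0 w1.
have -> : (z / w - a) * (z * w - a) =
    (cmod (1 - w) ^+ 2 - cmod (z - a) ^+ 2)%:C * (z * a).
  rewrite rmorphB mulrBl; transitivity
    ((1 - w) * (1 - w^-1) * (z * a) + (z - a) ^+ 2); first by field.
  rewrite cmodB_circle_sqr// mulNr -mulrBl; congr ((_ - _) * _).
  by rewrite -[RHS]/((cmod (1 - w) ^+ 2)%:C) -mulc_conj conjcB conjc1 conjc_unit.
by rewrite cmodM cmod_real cmodM z1 a1 !mulr1.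
Qed.

(** When k = |1 - w|^2, the bound k (4 - k) is |1 - w^2|^2: two points within one
    step of a are less than two steps apart.  If c is the cosine 1 - k/2 of a
    step, z + z' has scalar product more than 2 c with a, hence length more than 2 c,
    and the parallelogram law bounds the length of z - z'. *)
Lemma circle_close_pair z z' a (k : R) : cmod z = 1 -> cmod z' = 1 -> cmod a = 1 ->
  k <= 2 -> cmod (z - a) ^+ 2 < k -> cmod (z' - a) ^+ 2 < k ->
  cmod (z - z') ^+ 2 < k * (4 - k).
Proof.
move=> z1 z1' a1 k2 za z'a; have := parallelogram z z'; rewrite z1 z1' expr1n.
suff : (2 - k) ^+ 2 < cmod (z + z') ^+ 2 by nra.
have e (x : R[i]) : cmod x = 1 -> cmod (x - a) ^+ 2 = 2 - 2 * complex.Re (x * (conjc a)).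
  move: a1; case: x a {za z'a} => [x y] [u v].
  move=> /(congr1 (fun x => x ^+ 2)) + /(congr1 (fun x => x ^+ 2)).
  by rewrite !sqr_cmod /= !expr1n => h1 h2; nra.
rewrite !e// in za z'a.
have : 2 - k < complex.Re ((z + z') * (conjc a)) by rewrite mulrDl raddfD /=; lra.
have : complex.Re ((z + z') * (conjc a)) <= cmod (z + z').
  rewrite -[leRHS]mulr1 -a1 -(cmod_conj a) -cmodM.
  set x := (_ * _); apply: le_trans (ler_norm _) _.
  rewrite -(@ler_pXn2r _ 2)// ?nnegrE ?cmod_ge0// sqr_cmod real_normK ?num_real//.
  by rewrite lerDl sqr_ge0.
by move=> h1 h2; rewrite ltrXn2r// ?nnegrE; lra.
Qed.

End Chords.

(** * Sampling at the roots of unity and the Mahler measure *)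

Section Grid.
Local Open Scope complex_scope.
Variables (R : realType) (N : nat) (bad : R[i] -> bool).
Hypothesis N4 : (4 <= N)%N.
Let w : R[i] := cis (2 * pi / N%:R).
Hypothesis bad_isolated : forall z, z ^+ N = 1 -> ~~ (bad z && bad (z * w)).
Implicit Types (z a : R[i]).

Let N0 : (0 < N)%N. Proof. lia. Qed.
Let w1 : cmod w = 1. Proof. exact: cmod_cis. Qed.
Let pw : N.-primitive_root w. Proof. exact: cis_prim_root. Qed.
Let kappa : R := cmod (1 - w) ^+ 2.

Let NR : 4 <= N%:R :> R. Proof. by rewrite ler_nat. Qed.

Let NR0 : 0 < N%:R :> R. Proof. by rewrite ltr0n. Qed.

Let wX k : w ^+ k = cis (2 * pi / N%:R * k%:R).
Proof. by rewrite /w -cisMn mulr_natr. Qed.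

Let wl1 l : cmod (w ^+ l) = 1. Proof. by rewrite cmodX w1 expr1n. Qed.

Let kappa2 : kappa <= 2.
Proof.
have pi0 := pi_ge0 R; rewrite /kappa sqr_cmod_1Bcis.
suff : 0 <= cos (2 * pi / N%:R : R) by lra.
apply: cos_ge0_pihalf; apply/andP; split.
  by apply: (@le_trans _ _ 0); [lra | rewrite divr_ge0//; lra].
rewrite ler_pdivrMr//.
by have := ler_wpM2l pi0 NR; move: (N%:R : R) => M; lra.
Qed.

Let chord_far k : (2 <= k)%N -> (k <= N - 2)%N ->
  kappa * (4 - kappa) <= cmod (1 - w ^+ k) ^+ 2.
Proof.
move=> k2 kN; have pi0 := pi_ge0 R.
have -> : kappa * (4 - kappa) = cmod (1 - w ^+ 2) ^+ 2.
  have -> : 1 - w ^+ 2 = (1 - w) * (1 + w) by ring.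
  rewrite cmodM exprMn; have := parallelogram 1 w.
  by rewrite cmod1 w1 -/kappa => h; congr (_ * _); rewrite /kappa in h *; lra.
rewrite !wX !sqr_cmod_1Bcis; set h := _ / _.
have h0 : 0 <= h by rewrite /h divr_ge0// mulr_ge0.
have hN : h * N%:R = 2 * pi by rewrite /h divfK// gt_eqF.
rewrite lerD2l lerN2 ler_pM2l//; apply: cos_le_away.
- by rewrite mulr_ge0.
- by rewrite ler_wpM2l// ler_nat.
- by rewrite -hN -mulrBr ler_wpM2l// -natrB ?ler_nat//; lia.
Qed.

Let exceptional_uniq a l l' : cmod a = 1 -> (l < N)%N -> (l' < N)%N ->
  bad (w ^+ l) -> bad (w ^+ l') ->
  cmod (w ^+ l - a) ^+ 2 < kappa -> cmod (w ^+ l' - a) ^+ 2 < kappa -> l = l'.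
Proof.
move=> a1; wlog ll' : l l' / (l < l')%N => [H|].
  move=> lN lN' b b' c c'; have [ll'|ll'|//] := ltngtP l l'.
  - exact: H.
  - by apply/esym; exact: H.
move=> lN lN' b b' c c'; exfalso.
have wN m : (w ^+ m) ^+ N = 1 by rewrite -exprM mulnC exprM (prim_expr_order pw) expr1n.
have := circle_close_pair (wl1 l) (wl1 l') a1 kappa2 c c'.
have -> : cmod (w ^+ l - w ^+ l') = cmod (1 - w ^+ (l' - l)).
  by rewrite -{1}(subnKC (ltnW ll')) exprD -{1}[w ^+ l]mulr1 -mulrBr cmodM wl1 mul1r.
rewrite ltNge chord_far//.
- rewrite ltn_neqAle subn_gt0 ll' andbT; apply/negP => /eqP e.
  have /negP := bad_isolated (wN l); apply; rewrite b -exprSr.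
  by have -> : l.+1 = l' by lia.
- rewrite leqNgt; apply/negP => h; have [l0 l'1] : l = 0%N /\ l' = N.-1 by lia.
  have /negP := bad_isolated (wN l'); apply; rewrite b' -exprSr l'1 prednK//.
  by rewrite (prim_expr_order pw) -(expr0 w) -l0.
Qed.

(** The roots are those of (z - X)^2, moved to the two neighbours of z when z is
    bad; either way only good points occur as roots. *)
Definition grid_factor z : {poly R[i]} :=
  if bad z then ((z / w)%:P - 'X) * ((z * w)%:P - 'X) else (z%:P - 'X) ^+ 2.

Definition grid_poly : {poly R[i]} := \prod_(l < N) grid_factor (w ^+ l).

Let cmod_factor a l : cmod a = 1 ->
  cmod (grid_factor (w ^+ l)).[a] <= Num.max kappa (cmod (w ^+ l - a) ^+ 2) /\
  (~~ (bad (w ^+ l) && (cmod (w ^+ l - a) ^+ 2 < kappa)) ->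
   cmod (grid_factor (w ^+ l)).[a] <= cmod (w ^+ l - a) ^+ 2).
Proof.
move=> a1; rewrite /grid_factor; case: ifP => b /=; last first.
  by rewrite !hornerE cmodX; split=> //; rewrite le_max lexx orbT.
rewrite !hornerE cmod_neighbours// -/kappa.
have k0 : 0 <= kappa by rewrite exprn_ge0// cmod_ge0.
have d0 : 0 <= cmod (w ^+ l - a) ^+ 2 by rewrite exprn_ge0// cmod_ge0.
split; last by rewrite -leNgt => h; rewrite ler_norml; apply/andP; split; lra.
rewrite le_max; have [h|h] := leP kappa (cmod (w ^+ l - a) ^+ 2).
  by apply/orP; right; rewrite ler_norml; apply/andP; split; lra.
by apply/orP; left; rewrite ler_norml; apply/andP; split; lra.
Qed.

Let prod_grid a : \prod_(l < N) (a - w ^+ l) = a ^+ N - 1.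
Proof.
have := congr1 (fun p => p.[a]) (factor_Xn_sub_1 pw).
rewrite /= !hornerE horner_prod big_mkord => <-.
by apply: eq_bigr => l _; rewrite !hornerE.
Qed.

Let prod_grid_but a (l0 : 'I_N) : cmod a = 1 ->
  cmod (\prod_(l < N | l != l0) (a - w ^+ l)) <= N%:R.
Proof.
move=> a1; have E : \prod_(l < N | l != l0) ('X - (w ^+ l)%:P) =
    \sum_(i < N) 'X^(N.-1 - i) * (w ^+ l0)%:P ^+ i.
  apply: (mulfI (negbT (polyXsubC_eq0 (w ^+ l0)))).
  rewrite -(bigD1 l0 (P := xpredT) (F := fun l : 'I_N => 'X - (w ^+ l)%:P))//.
  rewrite -subrXX -(big_mkord xpredT (fun l => 'X - (w ^+ l)%:P)).
  rewrite (factor_Xn_sub_1 pw) -polyC_exp -exprM mulnC exprM (prim_expr_order pw).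
  by rewrite expr1n.
have := congr1 (fun p => p.[a]) E; rewrite /= horner_prod horner_sum.
under eq_bigr do rewrite !hornerE.
move=> ->; apply: le_trans (cmod_sum _ _ _) _.
rewrite -[N in leRHS]card_ord -sumr_const; apply: ler_sum => i _.
by rewrite !hornerE cmodM !cmodX a1 w1 !expr1n mulr1.
Qed.

Let N2kappa : N%:R ^+ 2 * kappa <= 64.
Proof.
have pi4 : pi <= 4 :> R by have := pihalf_lt2 R; lra.
have t0 : 0 <= 2 * pi / N%:R :> R by rewrite divr_ge0// mulr_ge0// pi_ge0.
have := cmod_1Bcis_le t0; rewrite -/w ler_pdivlMr//.
have := cmod_ge0 (1 - w); rewrite /kappa -exprMn mulrC => c0 h.
have -> : 64 = 8 ^+ 2 :> R by ring.
by rewrite lerXn2r ?nnegrE ?mulr_ge0//; lra.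
Qed.

Lemma grid_poly_circle a : cmod a = 1 -> cmod grid_poly.[a] <= 64.
Proof.
move=> a1; rewrite /grid_poly horner_prod cmod_prod.
(* the only factor that can exceed |z - a|^2: a bad point less than a step away from a *)
pose exc (l : 'I_N) := bad (w ^+ l) && (cmod (w ^+ l - a) ^+ 2 < kappa).
have [/existsP[l0 l0e]|/existsPn ne] := boolP [exists l, exc l].
- rewrite (bigD1 l0)//=.
  (* the exceptional factor is at most the square of a step, about 2 pi / N, and the
     product of the N - 1 other distances to a is at most N *)
  apply: (@le_trans _ _ (kappa * N%:R ^+ 2)); last by rewrite mulrC.
  rewrite ler_pM ?cmod_ge0 ?prodr_ge0//=.
  + by move=> l _; exact: cmod_ge0.
  + have [+ _] := cmod_factor l0 a1; rewrite max_l//.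
    by case/andP: l0e => _ /ltW.
  apply: (@le_trans _ _ (\prod_(l < N | l != l0) (cmod (a - w ^+ l) ^+ 2))).
    apply: ler_prod => l ll0; rewrite cmod_ge0 /= [cmod (a - _)]cmod_distC.
    have [_ +] := cmod_factor l a1; apply.
    apply: contraNN ll0 => /andP[b c]; case/andP: l0e => b0 c0.
    by apply/eqP/val_inj; apply: (exceptional_uniq a1 (ltn_ord _) (ltn_ord _) b b0 c c0).
  rewrite prodrXl -cmod_prod lerXn2r ?nnegrE ?cmod_ge0//.
  exact: prod_grid_but.
- apply: (@le_trans _ _ (\prod_(l < N) (cmod (a - w ^+ l) ^+ 2))).
    apply: ler_prod => l _; rewrite cmod_ge0 /= [cmod (a - _)]cmod_distC.
    by have [_ +] := cmod_factor l a1; apply; exact: ne.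
  rewrite prodrXl -cmod_prod prod_grid.
  apply: (@le_trans _ _ (2 ^+ 2)); last by rewrite -natrX ler_nat.
  rewrite lerXn2r ?nnegrE ?cmod_ge0//.
  by rewrite (le_trans (cmodD _ _))// cmodN cmod1 cmodX a1 expr1n.
Qed.

Lemma grid_poly_outside a : a != 0 ->
  cmod grid_poly.[a] = cmod a ^+ (2 * N) * cmod grid_poly.[(conjc a)^-1].
Proof.
move=> a0; rewrite /grid_poly !horner_prod !cmod_prod.
have -> : cmod a ^+ (2 * N) = \prod_(l < N) cmod a ^+ 2.
  by rewrite prodr_const card_ord exprM.
rewrite -big_split; apply: eq_bigr => l _ /=; rewrite /grid_factor.
case: ifP => _; rewrite !hornerE.
  rewrite !cmodM [cmod (w ^+ l / w - a)]cmodB_reflect// ?cmodM ?cmodV ?wl1 ?w1 ?invr1 ?mulr1//.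
  rewrite [cmod (w ^+ l * w - a)]cmodB_reflect// ?cmodM ?wl1 ?w1 ?mulr1//.
  by ring.
by rewrite !cmodX [cmod (w ^+ l - a)]cmodB_reflect// exprMn.
Qed.

(** The maximum modulus principle handles |a| <= 1, and grid_poly has degree 2 N
    with roots on the circle, which handles |a| > 1 by reflection. *)
Lemma grid_poly_bound a : cmod grid_poly.[a] <= 64 * Num.max 1 (cmod a) ^+ (2 * N).
Proof.
have [a1|a1] := leP (cmod a) 1.
  by rewrite expr1n mulr1; apply: max_modulus a1 => z; exact: grid_poly_circle.
have a0 : a != 0 by rewrite -cmod_gt0; lra.
rewrite grid_poly_outside// mulrC ler_wpM2r ?exprn_ge0 ?cmod_ge0//.
apply: (@max_modulus _ _ 64) => [z|]; first exact: grid_poly_circle.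
by rewrite cmodV cmod_conj invf_le1; lra.
Qed.

(** Every factor of grid_poly has good points as its two roots, so its product
    over the roots of p has modulus at least G; the product of all these is also the
    product of |grid_poly(a)| over the roots a of p.  The exponent 2 N of the
    bound on grid_poly is what keeps the loss to a constant, after taking N-th
    roots. *)
Lemma sampling_mahler (c : R[i]) (s : seq R[i]) (G : R) (p := c *: \prod_(a <- s) ('X - a%:P)) :
  0 <= G -> cmod c = 1 -> (size s <= N)%N ->
  (forall z, z ^+ N = 1 -> ~~ bad z -> G <= cmod p.[z] ^+ 2) ->
  G <= 64 * (\prod_(a <- s) Num.max 1 (cmod a)) ^+ 2.
Proof.
move=> G0 c1 sN good; set M := \prod_(a <- s) _.
have M0 : 0 <= M by apply: prodr_ge0 => a _; rewrite le_max ler01.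
have pE z : cmod p.[z] = cmod (\prod_(a <- s) (z - a)).
  rewrite /p hornerZ cmodM c1 mul1r horner_prod; congr cmod.
  by apply: eq_bigr => a _; rewrite !hornerE.
have step (l : 'I_N) : G <= \prod_(a <- s) cmod (grid_factor (w ^+ l)).[a].
  have zN : (w ^+ l) ^+ N = 1.
    by rewrite -exprM mulnC exprM (prim_expr_order pw) expr1n.
  have wN := prim_expr_order pw; have w0 : w != 0 by rewrite -cmod_gt0 w1.
  rewrite -cmod_prod /grid_factor; case: ifPn => b; last first.
    have := good _ zN b; rewrite pE -cmodX -prodrXl.
    by under [X in _ -> _ <= cmod X]eq_bigr do rewrite !hornerE.
  under eq_bigr do rewrite !hornerE.
  rewrite big_split cmodM /= -!pE.
  have h1 : G <= cmod p.[w ^+ l * w] ^+ 2.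
    apply: good; first by rewrite exprMn zN wN mulr1.
    by have := bad_isolated zN; rewrite b.
  have h2 : G <= cmod p.[w ^+ l / w] ^+ 2.
    have zwN : (w ^+ l / w) ^+ N = 1 by rewrite expr_div_n zN wN divr1.
    by apply: good => //; have := bad_isolated zwN; rewrite divfK// b andbT.
  rewrite -(@ler_pXn2r _ 2)// ?nnegrE ?mulr_ge0 ?cmod_ge0//.
  by rewrite exprMn expr2 ler_pM.
suff : G ^+ N <= (64 * M ^+ 2) ^+ N.
  by rewrite ler_pXn2r ?nnegrE ?mulr_ge0 ?exprn_ge0.
apply: (@le_trans _ _ (\prod_(l < N) \prod_(a <- s) cmod (grid_factor (w ^+ l)).[a])).
  rewrite -[in leLHS](card_ord N) -prodr_const.
  by apply: ler_prod => l _; rewrite G0 step.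
rewrite exchange_big /=.
apply: (@le_trans _ _ (\prod_(a <- s) (64 * Num.max 1 (cmod a) ^+ (2 * N)))).
  apply: ler_prod => a _; rewrite prodr_ge0 => [|l _]; last exact: cmod_ge0.
  by rewrite -cmod_prod -horner_prod grid_poly_bound.
rewrite big_split /= prodrXl -/M exprMn -exprM big_const_seq count_predT iter_mulr mulr1.
by rewrite ler_wpM2r ?exprn_ge0// ler_weXn2l// ler1n.
Qed.

End Grid.

(** * Rudin-Shapiro polynomials *)

Section RudinShapiro.
Local Open Scope complex_scope.
Variable R : realType.
Implicit Types (z v : R[i]) (n m : nat).

Lemma rsPS n : rsP R n.+1 = rsP R n + 'X^(2 ^ n) * rsQ R n.
Proof. by rewrite /rsP /rsQ /=; case: rudin_shapiro. Qed.

Lemma rsQS n : rsQ R n.+1 = rsP R n - 'X^(2 ^ n) * rsQ R n.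
Proof. by rewrite /rsP /rsQ /=; case: rudin_shapiro. Qed.

Notation P n z := (rsP R n).[z] (only parsing).
Notation Q n z := (rsQ R n).[z] (only parsing).

Lemma horner_rsPS n z : P n.+1 z = P n z + z ^+ (2 ^ n) * Q n z.
Proof. by rewrite rsPS !hornerE. Qed.

Lemma horner_rsQS n z : Q n.+1 z = P n z - z ^+ (2 ^ n) * Q n z.
Proof. by rewrite rsQS !hornerE. Qed.

Lemma size_rs n : size (rsP R n) = (2 ^ n)%N /\ size (rsQ R n) = (2 ^ n)%N.
Proof.
elim: n => [|n [IHP IHQ]]; first by rewrite /rsP /rsQ /= size_poly1.
have Q0 : rsQ R n != 0 by rewrite -size_poly_gt0 IHQ expn_gt0.
have sX : size ('X^(2 ^ n) * rsQ R n) = (2 ^ n.+1)%N.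
  by rewrite mulrC size_mulXn// IHQ expnS mul2n addnn.
have lt : (size (rsP R n) < size ('X^(2 ^ n) * rsQ R n)%R)%N.
  by rewrite IHP sX ltn_exp2l.
by rewrite rsPS rsQS ![rsP R n + _]addrC !size_polyDl ?size_polyN.
Qed.

Lemma cmod_lead_rs n : cmod (lead_coef (rsP R n)) = 1 /\ cmod (lead_coef (rsQ R n)) = 1.
Proof.
elim: n => [|n [IHP IHQ]]; first by rewrite /rsP /rsQ /= lead_coef1 cmod1.
have [sP sQ] := size_rs n.
have Q0 : rsQ R n != 0 by rewrite -size_poly_gt0 sQ expn_gt0.
have lt : (size (rsP R n) < size ('X^(2 ^ n) * rsQ R n)%R)%N.
  by rewrite mulrC size_mulXn// sP sQ -[X in (X < _)%N]add0n ltn_add2r expn_gt0.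
have lX : lead_coef ('X^(2 ^ n) * rsQ R n) = lead_coef (rsQ R n).
  by rewrite lead_coefM lead_coefXn mul1r.
by rewrite rsPS rsQS ![rsP R n + _]addrC !lead_coefDl ?size_polyN// lead_coefN cmodN lX.
Qed.

Lemma rs_energy n z : cmod z = 1 -> cmod (P n z) ^+ 2 + cmod (Q n z) ^+ 2 = 2 ^+ n.+1.
Proof.
move=> z1; elim: n => [|n IH].
  by rewrite /rsP /rsQ /= !hornerE cmod1 expr1n.
by rewrite horner_rsPS horner_rsQS parallelogram cmodM cmodX z1 expr1n mul1r IH -exprS.
Qed.

(** The identities express that z^(2^n) conj(P_n(-z)) and z Q_n(z) agree up to
    sign, and likewise after exchanging P and Q with the opposite sign.  The
    opposition of signs is stable under the recursion, but false for P_0 = Q_0 = 1,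
    whence the shift of the index. *)
Lemma rs_reciprocal n z : cmod z = 1 -> exists b : bool,
  z ^+ (2 ^ n.+1) * conjc (P n.+1 (- z)) = (-1) ^+ b * z * Q n.+1 z /\
  z ^+ (2 ^ n.+1) * conjc (Q n.+1 (- z)) = - (-1) ^+ b * z * P n.+1 z.
Proof.
move=> z1; have z0 : z != 0 by rewrite -cmod_gt0 z1.
have conjD (x y : R[i]) : conjc (x + y) = conjc x + conjc y by exact: rmorphD.
have conjM (x y : R[i]) : conjc (x * y) = conjc x * conjc y by exact: rmorphM.
elim: n => [|n [b [IHP IHQ]]].
  exists true; rewrite !horner_rsPS !horner_rsQS /rsP /rsQ /= !hornerE.
  rewrite conjD conjcB conjc1 -[- z]mulN1r conjM (conjc_unit z1).
  have -> : conjc (-1 : R[i]) = -1 by rewrite -{2}conjc1; exact: rmorphN.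
  by split; field.
exists (~~ b); rewrite !(horner_rsPS n.+1) !(horner_rsQS n.+1) conjD conjcB !conjM.
have -> : (- z) ^+ (2 ^ n.+1) = z ^+ (2 ^ n.+1).
  by rewrite exprNn -signr_odd oddX /= expr0 mul1r.
have m1 : cmod (z ^+ (2 ^ n.+1)) = 1 by rewrite cmodX z1 expr1n.
rewrite (conjc_unit m1) [(2 ^ n.+2)%N]expnSr muln2 -addnn exprD.
set x := z ^+ _ in IHP IHQ m1 *; have x0 : x != 0 by rewrite -cmod_gt0 m1.
move: IHP IHQ; set p := conjc _; set q := conjc _ => IHP IHQ.
have sb : (-1) ^+ (~~ b) = - (-1) ^+ b :> R[i] by case: b {IHP IHQ} => /=; rewrite ?opprK.
rewrite sb opprK; split.
  transitivity (x * (x * p) + x * q); first by field.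
  by rewrite IHP IHQ; ring.
transitivity (x * (x * p) - x * q); first by field.
by rewrite IHP IHQ; ring.
Qed.

Lemma cmod_rsQ n z : cmod z = 1 -> cmod (Q n z) = cmod (P n (- z)).
Proof.
move=> z1; case: n => [|n]; first by rewrite /rsP /rsQ /= !hornerE.
have [b [/(congr1 (@cmod R)) + _]] := rs_reciprocal n z1.
by rewrite !cmodM !cmodX cmodN cmod1 z1 !expr1n !mul1r cmod_conj => ->.
Qed.

Lemma mahler_rotate_half (p q : {poly R[i]}) : p != 0 ->
  (forall z, cmod z = 1 -> cmod q.[z] = cmod p.[- z]) ->
  mahler p 0 (2 * pi) = mahler q 0 (2 * pi).
Proof.
move=> p0 pq; have [s ps] := closed_field_poly_normal p.
have lp0 : lead_coef p != 0 by rewrite lead_coef_eq0.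
transitivity (mahler (lead_coef p *: \prod_(a <- map -%R s) ('X - a%:P)) 0 (2 * pi)).
  rewrite {1}ps !jensen_formula// big_map; congr (_ * _).
  by apply: eq_bigr => a _; rewrite cmodN.
rewrite /mahler; congr (expR (_ * _)); apply: eq_Rintegral => t _; congr ln.
rewrite -!/(cmod _) pq ?cmod_cis// {2}ps !hornerZ !cmodM big_map !horner_prod.
rewrite !cmod_prod; congr (_ * _); apply: eq_bigr => a _.
by rewrite !hornerE -cmodN opprD opprK.
Qed.

Lemma mahler_rs n : mahler (rsP R n) 0 (2 * pi) = mahler (rsQ R n) 0 (2 * pi).
Proof.
apply: mahler_rotate_half => [|z z1]; last exact: cmod_rsQ.
by rewrite -size_poly_gt0 (size_rs n).1 expn_gt0.
Qed.

Lemma cmod_1BX v k : cmod v = 1 -> cmod (1 - v ^+ k) <= k%:R * cmod (1 - v).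
Proof.
move=> v1; elim: k => [|k IH]; first by rewrite expr0 subrr cmod0 mul0r.
have -> : 1 - v ^+ k.+1 = (1 - v ^+ k) + v ^+ k * (1 - v) by rewrite exprSr; ring.
rewrite (le_trans (cmodD _ _))// -natr1 mulrDl mul1r lerD//.
by rewrite cmodM cmodX v1 expr1n mul1r.
Qed.

Lemma sqr_cmodD_le (x y : R[i]) : cmod (x + y) ^+ 2 <= 2 * cmod x ^+ 2 + 2 * cmod y ^+ 2.
Proof.
by have := parallelogram x y; have := sqr_ge0 (cmod (x - y)) => *; lra.
Qed.

(** The phase c makes the comparison symmetric: passing from z to z v^2 turns the
    factor z^(2^n) by u^2, with u = v^(2^n), and multiplying c by u^-1 splits this
    into a turn by u^-1 of the P part and by u of the Q part, half as large.
    The parallelogram law doubles the squared norms, and both the error carried over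
    and the new turn are at most 2^n |1 - v|, relative to the norm of (P, Q), so that
    the relative error doubles. *)
Lemma rs_drift n z v : cmod z = 1 -> cmod v = 1 ->
  exists c : R[i], cmod c = 1 /\
    cmod (c * P n (z * v ^+ 2) - P n z) ^+ 2 + cmod (c * Q n (z * v ^+ 2) - Q n z) ^+ 2
    <= 2 ^+ n.+1 * (2 ^+ n * cmod (1 - v)) ^+ 2.
Proof.
move=> z1 v1; elim: n => [|n [c [c1 IH]]].
  have P0 x : P 0 x = 1 by rewrite /rsP /= hornerE.
  have Q0 x : Q 0 x = 1 by rewrite /rsQ /= hornerE.
  exists 1; rewrite cmod1; split=> //; rewrite !P0 ?Q0 mulr1 subrr cmod0.
  by rewrite expr0n addr0 mulr_ge0 ?sqr_ge0 ?exprn_ge0.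
pose u := v ^+ (2 ^ n); have u1 : cmod u = 1 by rewrite cmodX v1 expr1n.
have u0 : u != 0 by rewrite -cmod_gt0 u1.
have zn1 : cmod (z ^+ (2 ^ n)) = 1 by rewrite cmodX z1 expr1n.
exists (u^-1 * c); split; first by rewrite cmodM cmodV u1 invr1 mul1r.
rewrite !horner_rsPS !horner_rsQS.
have -> : (z * v ^+ 2) ^+ (2 ^ n) = z ^+ (2 ^ n) * u ^+ 2.
  by rewrite exprMn /u -!exprM mulnC.
set p := P n z in IH *; set q := Q n z in IH *; set x := z ^+ _ in zn1 *.
set p' := P n _ in IH *; set q' := Q n _ in IH *.
have -> : u^-1 * c * (p' + x * u ^+ 2 * q') - (p + x * q) =
    (u^-1 * (c * p') - p) + x * (u * (c * q') - q) by field.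
have -> : u^-1 * c * (p' - x * u ^+ 2 * q') - (p - x * q) =
    (u^-1 * (c * p') - p) - x * (u * (c * q') - q) by field.
rewrite parallelogram cmodM zn1 mul1r.
have h1 : cmod (u^-1 * (c * p') - p) ^+ 2 <=
    2 * cmod (c * p' - p) ^+ 2 + 2 * (cmod (1 - u) * cmod p) ^+ 2.
  have -> : cmod (u^-1 * (c * p') - p) = cmod ((c * p' - p) + (1 - u) * p).
    rewrite -[RHS]mul1r -[1 in RHS]invr1 -u1 -cmodV -cmodM.
    by congr cmod; field.
  by rewrite -cmodM sqr_cmodD_le.
have h2 : cmod (u * (c * q') - q) ^+ 2 <=
    2 * cmod (c * q' - q) ^+ 2 + 2 * (cmod (1 - u) * cmod q) ^+ 2.
  have -> : u * (c * q') - q = u * (c * q' - q) - (1 - u) * q by ring.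
  have := sqr_cmodD_le (u * (c * q' - q)) (- ((1 - u) * q)).
  by rewrite cmodN !cmodM u1 mul1r.
have := rs_energy n z1; rewrite -/p -/q => en.
have du : cmod (1 - u) <= 2 ^+ n * cmod (1 - v) by rewrite -natrX cmod_1BX.
have {du} : cmod (1 - u) ^+ 2 <= (2 ^+ n * cmod (1 - v)) ^+ 2.
  by rewrite lerXn2r ?nnegrE ?mulr_ge0 ?exprn_ge0 ?cmod_ge0.
rewrite !(exprMn _ (cmod (1 - u))) in h1 h2 => du.
have -> : 2 ^+ n.+2 * (2 ^+ n.+1 * cmod (1 - v)) ^+ 2 =
    8 * (2 ^+ n.+1 * (2 ^+ n * cmod (1 - v)) ^+ 2) by rewrite !exprS; ring.
have E0 : 0 <= 2 ^+ n.+1 :> R by rewrite exprn_ge0.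
have := ler_wpM2r E0 du; move: IH en h1 h2.
move: (2 ^+ n.+1) (cmod p ^+ 2) (cmod q ^+ 2) (cmod (1 - u) ^+ 2) => E sp sq k.
move: ((2 ^+ n * _) ^+ 2) => d IH en h1 h2 h3.
have : k * E = k * sp + k * sq by rewrite -en mulrDr.
by lra.
Qed.

(** P_{n+2} = P_{n+1} + z^(2^(n+1)) Q_{n+1}, and the sum and the difference of
    P_{n+1} and Q_{n+1} are 2 P_n and 2 z^(2^n) Q_n. *)
Lemma cmod_rs_grid n z : z ^+ (2 ^ n.+2) = 1 ->
  (cmod (P n.+2 z) = 2 * cmod (P n z) /\ z ^+ (2 ^ n.+1) = 1) \/
  (cmod (P n.+2 z) = 2 * cmod (Q n z) /\ z ^+ (2 ^ n.+1) = -1).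
Proof.
move=> zN; have z1 : cmod (z ^+ (2 ^ n)) = 1.
  apply/eqP; rewrite -(@eqrXn2 _ 4)// ?cmod_ge0// -cmodX -exprM expr1n.
  by rewrite (_ : (2 ^ n * 4)%N = 2 ^ n.+2)%N ?zN ?cmod1// !expnSr -mulnA.
have /eqP : (z ^+ (2 ^ n.+1)) ^+ 2 = 1 by rewrite -exprM -expnSr.
rewrite sqrf_eq1 horner_rsPS => /orP[/eqP zh|/eqP zh]; [left | right]; split=> //.
  rewrite zh mul1r horner_rsPS horner_rsQS.
  have -> : P n z + z ^+ (2 ^ n) * Q n z + (P n z - z ^+ (2 ^ n) * Q n z) =
    (2 : R)%:C * P n z by rewrite rmorph_nat; ring.
  by rewrite cmodM cmod_real ger0_norm.
rewrite zh mulN1r horner_rsPS horner_rsQS.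
have -> : P n z + z ^+ (2 ^ n) * Q n z - (P n z - z ^+ (2 ^ n) * Q n z) =
  (2 : R)%:C * (z ^+ (2 ^ n) * Q n z) by rewrite rmorph_nat; ring.
by rewrite cmodM cmod_real ger0_norm// cmodM z1 mul1r.
Qed.

(** If the two values were small, then by rs_energy the vectors (P, Q) at z and
    at z v^2 would be concentrated on different coordinates, against rs_drift. *)
Lemma rs_not_both_small n z v : cmod z = 1 -> cmod v = 1 -> 2 ^+ n * cmod (1 - v) <= 1 ->
  (2 ^+ n / 16 <= cmod (P n z) ^+ 2 \/ 2 ^+ n / 16 <= cmod (Q n (z * v ^+ 2)) ^+ 2) /\
  (2 ^+ n / 16 <= cmod (Q n z) ^+ 2 \/ 2 ^+ n / 16 <= cmod (P n (z * v ^+ 2)) ^+ 2).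
Proof.
move=> z1 v1 dv; have z1' : cmod (z * v ^+ 2) = 1 by rewrite cmodM cmodX z1 v1 expr1n mul1r.
have [c [c1 dr]] := rs_drift n z1 v1.
have {}dr := le_trans dr (_ : _ <= 2 ^+ n.+1).
have {}dr : cmod (c * P n (z * v ^+ 2) - P n z) ^+ 2 +
    cmod (c * Q n (z * v ^+ 2) - Q n z) ^+ 2 <= 2 * 2 ^+ n.
  rewrite -exprS; apply: dr; rewrite -[leRHS]mulr1 ler_wpM2l ?exprn_ge0//.
  by rewrite expr_le1// mulr_ge0 ?exprn_ge0 ?cmod_ge0.
have := rs_energy n z1; have := rs_energy n z1'; rewrite (exprS 2 n).
(* weights 4 and 4/3 in (d + b)^2 <= 4 b^2 + (4/3) d^2 leave room for the constant 1/16 *)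
have bnd (x y : R[i]) : cmod (c * x) ^+ 2 <= 4 * cmod y ^+ 2 + 4 / 3 * cmod (c * x - y) ^+ 2 /\
     cmod y ^+ 2 <= 4 * cmod (c * x) ^+ 2 + 4 / 3 * cmod (c * x - y) ^+ 2.
  have := cmodD (c * x - y) y; rewrite subrK.
  have := cmodD (y - c * x) (c * x); rewrite subrK [cmod (y - _)]cmod_distC.
  have := cmod_ge0 (c * x); have := cmod_ge0 y; have := cmod_ge0 (c * x - y).
  move: (cmod _) (cmod y) (cmod _) => a b d d0 b0 a0 h1 h2.
  have q1 : b ^+ 2 <= (d + a) ^+ 2 by rewrite lerXn2r ?nnegrE ?addr_ge0.
  have q2 : a ^+ 2 <= (d + b) ^+ 2 by rewrite lerXn2r ?nnegrE ?addr_ge0.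
  have := sqr_ge0 (3 * b - d); have := sqr_ge0 (3 * a - d).
  by split; nra.
have [p1 p2] := bnd (P n (z * v ^+ 2)) (P n z).
have [q1 q2] := bnd (Q n (z * v ^+ 2)) (Q n z).
rewrite [cmod (c * P n _)]cmodM [cmod (c * Q n _)]cmodM c1 !mul1r in p1 p2 q1 q2.
have : 0 < 2 ^+ n :> R by rewrite exprn_gt0.
move=> K0 e e'; split.
- by have [|lt1] := leP (2 ^+ n / 16) (cmod (P n z) ^+ 2); [left | right; lra].
- by have [|lt1] := leP (2 ^+ n / 16) (cmod (Q n z) ^+ 2); [left | right; lra].
Qed.

(** For n < 2 the right-hand side is large enough since every factor max(1, |a|)
    is at least 1.  For n >= 2, sampling_mahler applies with G = N / 16. *)
Lemma mahler_rs_lower n : 2 ^+ n <= 32 ^+ 2 * mahler (rsP R n) 0 (2 * pi) ^+ 2.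
Proof.
have [s ps] := closed_field_poly_normal (rsP R n).
have c1 := (cmod_lead_rs n).1.
have c0 : lead_coef (rsP R n) != 0 by rewrite -cmod_gt0 c1.
have M1 : 1 <= \prod_(a <- s) Num.max 1 (cmod a).
  by elim/big_ind: _ => // [x y|a _]; [exact: mulr_ege1 | rewrite le_max lexx].
rewrite ps jensen_formula// c1 mul1r; set M := \prod_(a <- s) _ in M1 *.
case: n ps c1 c0 => [|[|n]] ps c1 c0; rewrite ?expr0 ?expr1; try by nra.
pose N := (2 ^ n.+2)%N; have NE : N%:R = 4 * 2 ^+ n :> R.
  by rewrite natrX !exprS; ring.
have N4 : (4 <= N)%N by rewrite /N !expnS mulnA leq_pmulr// expn_gt0.
have NR : 0 < N%:R :> R by rewrite ltr0n; lia.
(* half a step of the grid, as the drift estimate compares z with z v^2 *)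
pose v : R[i] := cis (pi / N%:R).
have wE : cis (2 * pi / N%:R) = v ^+ 2 by rewrite -cisMn -mulrA mulr_natl.
pose bad z := cmod (P n.+2 z) ^+ 2 < N%:R / 16.
have v1 : cmod v = 1 by exact: cmod_cis.
have dv : 2 ^+ n * cmod (1 - v) <= 1.
  have t0 : 0 <= pi / N%:R :> R by rewrite divr_ge0 ?pi_ge0// ltW.
  have := cmod_1Bcis_le t0; rewrite -/v ler_pdivlMr// NE.
  by have := pihalf_lt2 R; move: (cmod _) (2 ^+ n) => x y *; lra.
have vN : (v ^+ 2) ^+ (2 ^ n.+1) = -1.
  rewrite -exprM -expnS -/N -cisMn -(mulr_natr (pi / N%:R)) divfK ?cis_pi//.
  by rewrite gt_eqF.
have isolated z : z ^+ N = 1 -> ~~ (bad z && bad (z * cis (2 * pi / N%:R))).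
  move=> zN; apply/negP; rewrite wE => /andP[]; rewrite /bad.
  have z1 : cmod z = 1.
    by apply/eqP; rewrite -(@eqrXn2 _ N) ?cmod_ge0 ?ler01//; [rewrite -cmodX zN cmod1 expr1n | lia].
  have zN' : (z * v ^+ 2) ^+ N = 1.
    by rewrite exprMn zN mul1r /N expnSr exprM vN sqrrN expr1n.
  have [s1 s2] := rs_not_both_small z1 v1 dv.
  have neq : (-1 : R[i]) <> 1.
    by move=> h; have := lt0r_neq0 (ltr0n R[i] 2); rewrite mulr2n -{1}h addNr eqxx.
  have zv : (z * v ^+ 2) ^+ (2 ^ n.+1) = - z ^+ (2 ^ n.+1) by rewrite exprMn vN mulrN1.
  have := cmod_rs_grid zN'; have := cmod_rs_grid zN; rewrite zv NE.
  move=> [[-> ->]|[-> ->]] [[-> e]|[-> e]].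
  - by case: neq.
  - by rewrite !exprMn; case: s1; lra.
  - by rewrite !exprMn; case: s2; lra.
  - by rewrite opprK in e; case: neq.
have sN : (size s <= N)%N.
  have := (size_rs n.+2).1; rewrite {1}ps size_scale// size_prod_XsubC => sE.
  by rewrite /N -sE.
have good z : z ^+ N = 1 -> ~~ bad z ->
    N%:R / 16 <= cmod (lead_coef (rsP R n.+2) *: \prod_(a <- s) ('X - a%:P)).[z] ^+ 2.
  by move=> _; rewrite -ps /bad -leNgt.
have := sampling_mahler N4 isolated (divr_ge0 (ltW NR) (ler0n _ 16)) c1 sN good.
by rewrite -/M -natrX -/N; lra.
Qed.

End RudinShapiro.

Theorem theorem2p1 (R : realType) :
  exists c1 : R, 0 < c1 /\
    forall n : nat,
      [/\ size (rsP R n) = (2 ^ n)%N,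
          size (rsQ R n) = (2 ^ n)%N,
          mahler (rsP R n) 0 (2 * pi) = mahler (rsQ R n) 0 (2 * pi) &
          c1 * Num.sqrt ((2 ^ n)%N%:R : R) <= mahler (rsQ R n) 0 (2 * pi)].
Proof.
exists 32^-1; split=> [|n]; first by rewrite invr_gt0.
have [sP sQ] := size_rs R n.
split; [exact: sP | exact: sQ | exact: mahler_rs | rewrite -mahler_rs].
rewrite mulrC ler_pdivrMr// natrX.
have M0 : 0 <= mahler (rsP R n) 0 (2 * pi) by exact: expR_ge0.
rewrite -(@ler_pXn2r _ 2)// ?nnegrE ?sqrtr_ge0 ?mulr_ge0//.
by rewrite sqr_sqrtr ?exprn_ge0// exprMn mulrC mahler_rs_lower.
Qed.
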